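(* Let $(X,\cdot)$ be a commutative semigroup and $M$ a maximal ideal of $\mathcal{P}(X)$. For $x\in X$ let $f_x:X\to X$ be the function $f_x(y)=x\cdot y$. Then the map $\zeta_M:\mathcal{P}(X)\to\mathcal{P}(X)$ given by $A\mapsto\{x\in X: f_x^{-1}(A)\notin M\}$ is a morphism of rings and $\theta_M=\operatorname{Spec}(\zeta_M)$.
   Context: $\mathcal{P}(X)$ denotes the power set ring of $X$: the set of all subsets of $X$ with addition $A+B=(A\cup B)\setminus(A\cap B)$ and multiplication $A\cdot B=A\cap B$. $\beta X=\operatorname{Spec}\mathcal{P}(X)$ with the Zariski topology, together with the map $\eta:X\to\beta X$, $x\mapsto\mathfrak{m}_x=\mathcal{P}(X\setminus\{x\})$, is the Stone–Čech compactification of the discrete space $X$: every function from $X$ to a quasi-compact Hausdorff space $Y$ factors uniquely as $\widetilde\varphi\circ\eta$ with $\widetilde\varphi:\beta X\to Y$ continuous. For $x\in X$, $\phi_x:\beta X\to\beta X$ is the unique continuous map with $\phi_x(\mathfrak{m}_y)=\mathfrak{m}_{x\cdot y}$ for all $y\in X$. For $M\in\beta X$, $\theta_M:\beta X\to\beta X$ is the unique continuous map with $\theta_M(\mathfrak{m}_x)=\phi_x(M)$ for all $x\in X$. For a ring morphism $h:R\to R'$, $\operatorname{Spec}(h):\operatorname{Spec}(R')\to\operatorname{Spec}(R)$ is $\mathfrak{p}\mapsto h^{-1}(\mathfrak{p})$. *)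

(* Defs.v *)
From HB Require Import structures.
From mathcomp Require Import all_boot all_order all_algebra.
From mathcomp Require Import all_classical topology.

Set Implicit Arguments.
Unset Strict Implicit.
Unset Printing Implicit Defensive.

Import GRing.Theory.
Local Open Scope classical_set_scope.
Local Open Scope ring_scope.

(* The ideals of mathcomp's ring_quotient are bundled over nzRingType, whereas
   the power set ring of an empty type is zero; hence the definitions below. *)

Section Ideals.
Variable R : comPzRingType.

Definition ideal (I : set R) : Prop :=
  [/\ I 0, (forall a b, I a -> I b -> I (a + b)) &
      (forall a b, I b -> I (a * b))].

Definition prime_ideal (I : set R) : Prop :=
  [/\ ideal I, I <> setT & (forall a b, I (a * b) -> I a \/ I b)].

Definition maximal_ideal (I : set R) : Prop :=
  [/\ ideal I, I <> setT &
      (forall J, ideal J -> I `<=` J -> J = I \/ J = setT)].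

Lemma ideal1 (I : set R) : ideal I -> I 1 -> I = setT.
Proof.
move=> [_ _ IM] I1; apply/seteqP; split=> // a _.
by rewrite -[a]mulr1; apply: IM.
Qed.

Lemma maximal_prime (I : set R) : maximal_ideal I -> prime_ideal I.
Proof.
move=> [idI properI maxI]; split=> // a b Iab.
have [I0 ID IM] := idI.
pose J := [set x | exists c d, I c /\ x = c + d * a].
have idJ : ideal J.
  split.
  - by exists 0, 0; split=> //; rewrite mul0r addr0.
  - move=> _ _ [c [d [Ic ->]]] [c' [d' [Ic' ->]]].
    exists (c + c'), (d + d'); split; first exact: ID.
    by rewrite mulrDl addrACA.
  - move=> x _ [c [d [Ic ->]]]; exists (x * c), (x * d).
    by split; [exact: IM|rewrite mulrDr mulrA].
have sIJ : I `<=` J by move=> c Ic; exists c, 0; rewrite mul0r addr0.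
have [eJ|eJ] := maxI J idJ sIJ.
  left; rewrite -eJ; exists 0, 1; split=> //.
  by rewrite mul1r add0r.
have [c [d [Ic e1]]] : J 1 by rewrite eJ.
right; rewrite -[b]mul1r e1 mulrDl; apply: ID.
  by rewrite mulrC; exact: IM.
by rewrite -mulrA; exact: IM.
Qed.

End Ideals.

Record spec (R : comPzRingType) : Type := Spec {
  spec_ideal :> R -> Prop;
  spec_prime : prime_ideal spec_ideal
}.

Lemma spec_inj (R : comPzRingType) (p q : spec R) :
  spec_ideal p = spec_ideal q -> p = q.
Proof.
case: p q => [p hp] [q hq] /= e.
by case: _ / e in hq *; congr Spec; exact: Prop_irrelevance.
Qed.

HB.instance Definition _ (R : comPzRingType) := gen_eqMixin (spec R).
HB.instance Definition _ (R : comPzRingType) := gen_choiceMixin (spec R).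

Section Zariski.
Variable R : comPzRingType.

Definition zeros (E : set R) : set (spec R) := [set p | E `<=` spec_ideal p].

Definition zariski_open (O : set (spec R)) : Prop :=
  exists E : set R, O = ~` zeros E.

Lemma zariski_openT : zariski_open setT.
Proof.
exists setT; rewrite -setC0; congr (~` _); apply/seteqP; split=> // p Tp.
by have [_ + _] := spec_prime p; apply; apply/seteqP; split.
Qed.

Lemma zariski_openI : setI_closed zariski_open.
Proof.
move=> _ _ [E ->] [F ->].
exists [set x | exists a b, [/\ E a, F b & x = a * b]].
rewrite -setCU; congr (~` _); apply/seteqP; split=> [p|p EFp].
  have [[_ _ pM] _ _] := spec_prime p.
  move=> [Ep|Fp] _ [a [b [Ea Fb ->]]]; last exact/pM/Fp.
  by rewrite mulrC; exact/pM/Ep.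
have [_ _ pP] := spec_prime p.
apply: contrapT => /not_orP [/existsNP [a /not_implyP [Ea npa]]].
move=> /existsNP [b /not_implyP [Fb npb]].
by have [] := pP a b; first by apply: EFp; exists a, b.
Qed.

Lemma zariski_open_bigU (J : Type) (f : J -> set (spec R)) :
  (forall i, zariski_open (f i)) -> zariski_open (\bigcup_i f i).
Proof.
move=> /choice [E fE]; exists (\bigcup_i E i).
rewrite -[LHS]setCK setC_bigcup; congr (~` _); apply/seteqP; split=> [p|p] h.
  by move=> a [i _ Ea]; have := h i I; rewrite fE setCK => /(_ a Ea).
by move=> i _; rewrite fE setCK => a Ea; apply: h; exists i.
Qed.

HB.instance Definition _ :=
  isOpenTopological.Build (spec R)
    zariski_openT zariski_openI zariski_open_bigU.

End Zariski.

Section SpecMap.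
Variables (R R' : comPzRingType) (h : {rmorphism R -> R'}).

Lemma spec_map_prime (p : spec R') : prime_ideal (h @^-1` spec_ideal p).
Proof.
have [[p0 pD pM] pT pP] := spec_prime p; split.
- split=> [|a b|a b] /=; first by rewrite rmorph0.
  + by rewrite rmorphD; exact: pD.
  + by rewrite rmorphM; exact: pM.
- move=> e; apply/pT/ideal1 => //.
  have : (h @^-1` spec_ideal p) 1 by rewrite e.
  by rewrite /= rmorph1.
- by move=> a b /=; rewrite rmorphM; exact: pP.
Qed.

Definition spec_map (p : spec R') : spec R := Spec (spec_map_prime p).

End SpecMap.

Definition powerset_ring (X : Type) : Type := set X.

HB.instance Definition _ (X : Type) := Choice.on (powerset_ring X).

HB.instance Definition _ (X : Type) :=
  GRing.isZmodule.Build (powerset_ring X)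
    (@setYA X) (@setYC X) (@set0Y X) (@setYK X).

HB.instance Definition _ (X : Type) :=
  GRing.Zmodule_isComPzRing.Build (powerset_ring X)
    (@setIA X) (@setIC X) (@setTI X) (@setIYl X).

(* [setY] is the union of the two differences. *)
Lemma powerset_addE (X : Type) (A B : powerset_ring X) :
  A + B = (A `|` B) `\` (A `&` B).
Proof. exact: setYE. Qed.

Notation beta X := (spec (powerset_ring X)).

Section StoneCech.
Variable X : Type.
Implicit Types (p q : beta X) (A B : powerset_ring X).

Lemma principal_prime (x : X) :
  prime_ideal ([set A | A `<=` ~` [set x]] : set (powerset_ring X)).
Proof.
split.
- split=> // [A B Ax Bx y|A B Bx y [_ /Bx//]].
  by move=> [[/Ax]|[/Bx]].
- by move=> e; have : [set A | A `<=` ~` [set x]] [set: X];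
    [rewrite e|move=> /(_ x I); apply].
- move=> A B ABx; have [Ax|nAx] := pselect (A x); last first.
    by left=> y Ay yx; apply: nAx; rewrite -yx.
  by right=> y By yx; apply: (ABx y) => //; split=> //; rewrite yx.
Qed.

Definition eta (x : X) : beta X := Spec (principal_prime x).

Lemma beta0 p : p set0.
Proof. by have [[]] := spec_prime p. Qed.

Lemma betaT p : ~ p setT.
Proof. by move=> pT; have [idp + _] := spec_prime p; apply; exact: ideal1. Qed.

Lemma betaS p A B : A `<=` B -> p B -> p A.
Proof.
move=> sAB pB; have [[_ _ pM] _ _] := spec_prime p.
by have := pM A B pB; rewrite [A * B](setIidl sAB).
Qed.

Lemma betaI p A B : p (A `&` B) -> p A \/ p B.
Proof. by have [_ _] := spec_prime p; apply. Qed.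

Lemma betaU p A B : p A -> p B -> p (A `|` B).
Proof.
have [[_ pD _] _ _] := spec_prime p => pA pB.
rewrite -setYU; apply: (pD); first exact: pD.
by apply: betaS pA => x [].
Qed.

Lemma betaC p A : p (~` A) <-> ~ p A.
Proof.
split=> [pC pA|npA].
  by apply: (@betaT p); rewrite -(setUv A); exact: betaU.
have [|//|//] := @betaI p A (~` A).
by rewrite setICr; exact: beta0.
Qed.

Let D A : set (beta X) := [set p | ~ p A].

Lemma beta_nbhs p A : ~ p A -> nbhs p (D A).
Proof.
move=> npA; exists (D A); split=> //; exists [set A].
by congr (~` _); apply/seteqP; split=> q /= => [pA _ -> //|]; exact.
Qed.

Lemma nbhs_beta p (W : set (beta X)) :
  nbhs p W -> exists2 A, ~ p A & D A `<=` W.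
Proof.
move=> [_ [[E ->] /existsNP[A /not_implyP[EA npA]] sW]].
by exists A => // q nqA; apply: sW => /(_ A EA).
Qed.

Definition beta_filter p : set_system X := [set A | ~ p A].

Instance beta_filter_proper p : ProperFilter (beta_filter p).
Proof.
apply: Build_ProperFilter => [|]; first by move=> /(_ (beta0 p)).
split; first exact: betaT.
- by move=> A B nA nB /betaI[].
- by move=> A B sAB nA /(betaS sAB).
Qed.

Lemma beta_hausdorff : hausdorff_space (beta X).
Proof.
move=> p q pq; apply/spec_inj/seteqP; split=> A => [pA|qA].
  have npA : ~ p (~` A) by move=> /betaC.
  apply: contrapT => nqA.
  have [r [/= nrC nrA]] := pq _ _ (beta_nbhs npA) (beta_nbhs nqA).
  exact/nrC/betaC.
have nqA : ~ q (~` A) by move=> /betaC.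
apply: contrapT => npA.
have [r [/= nrA nrC]] := pq _ _ (beta_nbhs npA) (beta_nbhs nqA).
exact/nrC/betaC.
Qed.

Lemma beta_compact : compact [set: beta X].
Proof.
rewrite compact_ultra => F FU _.
have pr : prime_ideal ([set A | ~ F (D A)] : set (powerset_ring X)).
  have F1 A : F (D A) \/ F (~` D A) by exact: in_ultra_setVsetC.
  split; [split|..].
  - move=> F0; apply: (@filter_not_empty _ F _); apply: filterS F0 => p.
    by apply; exact: beta0.
  - move=> A B FA FB FAB.
    have [//|{}FA] := F1 A; have [//|{}FB] := F1 B.
    apply: (@filter_not_empty _ F _).
    near F => p; have [] : [/\ (~` D A) p, (~` D B) p & D (A + B) p].
      by split; near: p.
    move=> /contrapT pA /contrapT pB; case.
    by have [[_ pD _] _ _] := spec_prime p; exact: pD.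
  - move=> A B FB FAB; apply: FB; apply: filterS FAB => p /= h pB; apply: h.
    by have [[_ _ pM] _ _] := spec_prime p; exact: pM.
  - move=> e; have : [set A | ~ F (D A)] [set: X] by rewrite e.
    by apply; apply: filterS filterT => p _; exact: betaT.
  - move=> A B FAB; apply: contrapT => /not_orP[/contrapT FA /contrapT FB].
    by apply: FAB; apply: filterS2 FA FB => p nA nB /betaI[].
exists (Spec pr); split=> // W /nbhs_beta[A /contrapT FA sAW].
exact: filterS FA.
Unshelve. all: by end_near. Qed.

Lemma stone_cech (Y : topologicalType) (phi : X -> Y) :
  compact [set: Y] -> hausdorff_space Y ->
  exists! g : beta X -> Y, continuous g /\ g \o eta = phi.
Proof.
move=> cY hY.
have cvg_ext g : continuous g -> g \o eta = phi ->
    forall p, phi @ beta_filter p --> g p.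
  move=> cg <- p W /cg /nbhs_beta[A npA sA].
  move=> pW; apply: npA; apply: betaS pW => x Ax.
  by apply: (sA (eta x)) => /(_ x Ax); apply.
have lim p : exists y : Y, phi @ beta_filter p --> y.
  have FU : UltraFilter (phi @ beta_filter p).
    split; first exact: fmap_proper_filter.
    move=> G GF sG; apply/seteqP; split=> // A GA pA.
    apply: (@filter_not_empty _ G GF); rewrite -(setICr A).
    by apply: filterI => //; apply: sG => /betaC; apply.
  move: (cY); rewrite compact_ultra => /(_ _ FU filterT)[y [_ ?]].
  by exists y.
have [g gP] := choice lim.
exists g; split; last first.
  move=> g' [cg' eg']; apply/funext => p.
  exact: (cvg_unique hY (gP p) (cvg_ext g' cg' eg' p)).
split.
  move=> p W Wgp.
  have [K Kgp sKW] := compact_regular hY cY filterT Wgp.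
  apply: filterS (beta_nbhs (gP p K Kgp)) => q nq; apply: sKW => V Vgq.
  apply: (@filter_ex _ (phi @ beta_filter q)).
  exact: (@filterI _ (phi @ beta_filter q) _ _ _ nq (gP q V Vgq)).
apply/funext => x; apply: (cvg_unique hY (gP (eta x))) => W /nbhs_singleton Wx.
by move=> /(_ x Wx); apply.
Qed.

Section Extension.
Variables (Y : topologicalType) (cY : compact [set: Y]).
Variables (hY : hausdorff_space Y) (phi : X -> Y).

Definition stone_cech_ext : beta X -> Y :=
  sval (cid (stone_cech phi cY hY)).

Lemma stone_cech_ext_continuous : continuous stone_cech_ext.
Proof.
by rewrite /stone_cech_ext; case: cid => g [[]].
Qed.

Lemma stone_cech_ext_eta (x : X) : stone_cech_ext (eta x) = phi x.
Proof.
rewrite /stone_cech_ext; case: cid => g /=.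
by case=> [[_ <-]].
Qed.

Lemma stone_cech_ext_unique (g : beta X -> Y) :
  continuous g -> (forall x, g (eta x) = phi x) -> g = stone_cech_ext.
Proof.
rewrite /stone_cech_ext; case: cid => f /=.
by case=> _ uf cg ge; apply/esym/uf; split=> //; exact/funext.
Qed.

End Extension.

End StoneCech.

Section Multiplication.
Variables (X : Type) (op : X -> X -> X).

Definition phi (x : X) : beta X -> beta X :=
  stone_cech_ext (@beta_compact X) (@beta_hausdorff X) (fun y => eta (op x y)).

Definition theta (M : beta X) : beta X -> beta X :=
  stone_cech_ext (@beta_compact X) (@beta_hausdorff X) (fun x => phi x M).

Definition zeta (M : set (powerset_ring X)) (A : powerset_ring X) :
    powerset_ring X :=
  [set x | ~ M (op x @^-1` A)].

End Multiplication.

(* Main.v *)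
From HB Require Import structures.
Require Import Defs.
From mathcomp Require Import all_boot all_order all_algebra.
From mathcomp Require Import all_classical topology.

(** Ring morphisms [powerset_ring X -> powerset_ring Y] are the same thing as
functions [q : Y -> beta X]: read at a point [y], a morphism is a ring map to
the field with two elements, and such a map is determined by its kernel, a
prime ideal [q y].  Explicitly, [q] corresponds to
[A |-> {y | A is not in q y}].  The Spec of this morphism is continuous and
sends [eta y] to [q y], so it is the Stone-Cech extension of [q]
([stone_cech_ext_spec_map]).

Both continuous maps of the theorem arise in this way.  For
[q y = eta (op x y)] the morphism is the preimage under [op x], so
[phi op x p] is the ideal of those [A] whose preimage under [op x] lies in [p]
([phiE]).  Hence for [q x = phi op x p] the morphism is exactly [zeta op p],
and the extension of this [q] is [theta op p] by definition. *)

Set Implicit Arguments.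
Unset Strict Implicit.
Unset Printing Implicit Defensive.

Import GRing.Theory.
Local Open Scope classical_set_scope.
Local Open Scope ring_scope.

Local Notation beta X := (spec (powerset_ring X)).

Lemma spec_map_continuous (R R' : comPzRingType) (h : {rmorphism R -> R'}) :
  continuous (spec_map h).
Proof.
apply/continuousP => _ [E ->]; exists (h @` E).
rewrite preimage_setC; congr (~` _); apply/seteqP; split=> p hE.
  by move=> _ [a Ea <-]; exact: hE.
by move=> a Ea; apply: hE; exists a.
Qed.

(** Sums are symmetric differences, and the quotient by a point of [beta X]
is the field with two elements. *)
Lemma beta_add X (p : beta X) (A B : powerset_ring X) :
  p (A + B) <-> (p A <-> p B).
Proof.
have [[_ pD _] _ _] := spec_prime p; split=> [pAB|].
  split=> [pA|pB].
    by have := pD _ _ pA pAB; rewrite [A + (A + B)]setYA setYK set0Y.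
  by have := pD _ _ pAB pB; rewrite -[A + B + B]setYA setYK setY0.
have [pA|npA] := pselect (p A); first by move=> [/(_ pA) pB _]; exact: pD.
move=> [_ BA]; have npB : ~ p B by move=> /BA.
have := pD _ _ ((betaC p A).2 npA) ((betaC p B).2 npB).
(* Complementing both summands leaves a symmetric difference unchanged. *)
suff -> : A + B = (~` A : powerset_ring X) + (~` B : powerset_ring X) by [].
by rewrite [RHS]setUC; congr (_ `|` _); rewrite !setDE setCK setIC.
Qed.

Section MorphismOfPoints.
Variables (X Y : Type) (q : Y -> beta X).

Definition morphism_of_points (A : powerset_ring X) : powerset_ring Y :=
  [set y | ~ q y A].

Lemma morphism_of_points_is_zmod_morphism : zmod_morphism morphism_of_points.
Proof.
move=> A B.
(* Negation in a power set ring is defined as the identity. *)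
change (morphism_of_points (A + B) =
        morphism_of_points A + morphism_of_points B).
apply/seteqP; split=> y /=.
  move=> nqAB; have [qA|nqA] := pselect (q y A).
    by right; split=> [qB|]; [apply/nqAB/beta_add|apply].
  left; split=> // nqB; apply/nqAB/beta_add.
  by split=> [/nqA|/nqB].
by move=> [[nqA /contrapT qB]|[nqB /contrapT qA]] /beta_add [AB BA];
  [apply/nqA/BA|apply/nqB/AB].
Qed.

Lemma morphism_of_points_is_monoid_morphism :
  monoid_morphism morphism_of_points.
Proof.
split; first by apply/seteqP; split=> // y _; exact: betaT.
move=> A B; apply/seteqP; split=> y /=.
  by move=> nqAB; split=> qA; apply: nqAB; apply: betaS qA => x [].
by move=> [nqA nqB] /betaI[].
Qed.

HB.instance Definition _ :=
  GRing.isZmodMorphism.Build (powerset_ring X) (powerset_ring Y)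
    morphism_of_points morphism_of_points_is_zmod_morphism.
HB.instance Definition _ :=
  GRing.isMonoidMorphism.Build (powerset_ring X) (powerset_ring Y)
    morphism_of_points morphism_of_points_is_monoid_morphism.

(** [A] lies in the image of [eta y] under Spec exactly when [y] is not in
[morphism_of_points A], that is, when [A] lies in [q y]. *)
Lemma stone_cech_ext_spec_map :
  stone_cech_ext (@beta_compact X) (@beta_hausdorff X) q =
  spec_map morphism_of_points.
Proof.
apply/esym/stone_cech_ext_unique; first exact: spec_map_continuous.
move=> y; apply/spec_inj/seteqP; split=> A /=.
  by move=> sAy; apply: contrapT => /sAy; apply.
by move=> qA z nqA zy; apply: nqA; rewrite zy.
Qed.

End MorphismOfPoints.

Lemma phiE X (op : X -> X -> X) x (p : beta X) A :
  phi op x p A <-> p (op x @^-1` A).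
Proof.
rewrite /phi stone_cech_ext_spec_map /=.
suff -> : morphism_of_points (fun y => eta (op x y)) A = op x @^-1` A by [].
apply/seteqP; split=> y /=.
  move=> nA; apply: contrapT => nAxy; apply: nA => z Az zE.
  by apply: nAxy; rewrite -zE.
by move=> Axy /(_ _ Axy); apply.
Qed.

Theorem theorem9p2 (X : Type) (op : SemiGroup.com_law X)
    (M : set (powerset_ring X)) (maxM : maximal_ideal M) :
  exists h : {rmorphism powerset_ring X -> powerset_ring X},
    (h : powerset_ring X -> powerset_ring X) = zeta op M /\
    theta op (Spec (maximal_prime maxM)) = spec_map h.
Proof.
pose q x := phi op x (Spec (maximal_prime maxM)).
exists (morphism_of_points q); split; last exact: stone_cech_ext_spec_map.
apply/funext => A; apply/seteqP; split=> x /=.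
  by move=> nqA MA; apply: nqA; apply/phiE.
by move=> nMA /phiE.
Qed.
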